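(* Let $r \ge 3$ be an integer and let $A$ be a (square) real TN$_r$ (resp. TP$_r$) Hankel matrix. Then, for all real $t \ge r-2$, the Hadamard power $A^{\circ t}$ is a TN$_r$ (resp. TP$_r$) Hankel matrix.
   Context: A square matrix $A=(a_{ij})_{1\le i,j\le n}$ is Hankel if $a_{ij}$ depends only on $i+j$. A real matrix is TN$_r$ (totally nonnegative of order $r$) if every minor (determinant of a square submatrix) of size $\le r$ is nonnegative, and TP$_r$ (totally positive of order $r$) if every minor of size $\le r$ is positive. For a matrix $A=(a_{ij})$ with nonnegative real entries and a real number $t>0$, the Hadamard (entrywise) power is $A^{\circ t}=(a_{ij}^t)$ (with $0^t=0$). *)

(* Defs.v *)
From HB Require Import structures.
From mathcomp Require Import all_boot all_order all_algebra.
From mathcomp Require Import reals exp.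

Set Implicit Arguments.
Unset Strict Implicit.
Unset Printing Implicit Defensive.

Import Order.TTheory GRing.Theory Num.Theory.

Local Open Scope ring_scope.

Definition hankel (R : Type) (n : nat) (A : 'M[R]_n) : Prop :=
  forall i j i' j' : 'I_n, (i + j = i' + j')%N -> A i j = A i' j'.

Definition increasing (k n : nat) (f : 'I_k -> 'I_n) : Prop :=
  forall i j : 'I_k, (i < j)%N -> (f i < f j)%N.

(* A minor of size k is indexed by increasing sequences of rows and columns;
   the empty minor (k = 0) equals 1, so allowing it changes nothing. *)
Definition TN (R : realType) (r n : nat) (A : 'M[R]_n) : Prop :=
  forall (k : nat) (f g : 'I_k -> 'I_n),
    (k <= r)%N -> increasing f -> increasing g -> 0 <= \det (mxsub f g A).

Definition TP (R : realType) (r n : nat) (A : 'M[R]_n) : Prop :=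
  forall (k : nat) (f g : 'I_k -> 'I_n),
    (k <= r)%N -> increasing f -> increasing g -> 0 < \det (mxsub f g A).

(* For t > 0, powR satisfies 0 `^ t = 0; its value at negative reals is
   a junk value. *)
Definition hadamard_power (R : realType) (n : nat) (A : 'M[R]_n) (t : R) :
  'M[R]_n := map_mx (fun x => x `^ t) A.

(* Main.v *)
(**
  Contiguous submatrices of a Hankel matrix are symmetric, so those of size at
  most [r] of a TN_r Hankel matrix are positive semidefinite, and positive
  definite in the TP_r case. By the FitzGerald-Horn theorem the entrywise power
  [t >= k - 2] preserves positive definiteness of a k x k matrix with positive
  entries: with [z] the first column of [A] divided by the square root of
  [A 0 0], the mean value theorem on the segment from [z z^T] to [A] gives
  [A^t - (z z^T)^t = t (A - z z^T) o C^(t-1)] for some [C] on the segment (inside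
  the quadratic form of a fixed vector). Here [A - z z^T] lives on a
  (k-1) x (k-1) block, so induction and the Schur product theorem apply. Hence
  the contiguous minors of size at most [r] of the power are positive, and
  Fekete's criterion extends this to all minors of size at most [r]. A TN_r
  Hankel matrix is a limit of TP_r ones: add a small multiple of the Hankel
  matrix of power sums of distinct positive numbers.
*)
Require Import Defs.
From HB Require Import structures.
From mathcomp Require Import all_boot all_order all_algebra.
From mathcomp Require Import reals exp.
From mathcomp Require Import boolp classical_sets functions topology normedtype.
From mathcomp Require Import derive realfun ring lra.

Set Implicit Arguments.
Unset Strict Implicit.
Unset Printing Implicit Defensive.

Import Order.TTheory GRing.Theory Num.Theory.
Import numFieldNormedType.Exports.

Local Open Scope ring_scope.

(** * Quadratic forms and Schur complements *)

Definition qf (R : realType) (n : nat) (A : 'M[R]_n) (v : 'I_n -> R) : R :=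
  \sum_i \sum_j A i j * (v i * v j).

Definition psd (R : realType) (n : nat) (A : 'M[R]_n) : Prop :=
  A^T = A /\ forall v, 0 <= qf A v.

Definition pd (R : realType) (n : nat) (A : 'M[R]_n) : Prop :=
  A^T = A /\ forall v, (exists i, v i != 0) -> 0 < qf A v.

(* With [x / 0 = 0], a vanishing first row makes this the lower right block. *)
Definition schur (R : realType) (n : nat) (A : 'M[R]_n.+1) : 'M[R]_n :=
  \matrix_(i, j) (A (lift ord0 i) (lift ord0 j)
                  - A (lift ord0 i) ord0 * A ord0 (lift ord0 j) / A ord0 ord0).

Lemma sym_mxE (R : realType) (n : nat) (A : 'M[R]_n) i j :
  A^T = A -> A i j = A j i.
Proof. by move=> /matrixP/(_ j i); rewrite mxE. Qed.

Lemma eq_qf (R : realType) (n : nat) (A B : 'M[R]_n) (v w : 'I_n -> R) :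
  A =2 B -> v =1 w -> qf A v = qf B w.
Proof.
move=> eqA eqv; apply: eq_bigr => i _; apply: eq_bigr => j _.
by rewrite eqA !eqv.
Qed.

Lemma qfD (R : realType) (n : nat) (A B : 'M[R]_n) (v : 'I_n -> R) :
  qf (A + B) v = qf A v + qf B v.
Proof.
rewrite /qf -big_split /=; apply: eq_bigr => i _.
by rewrite -big_split /=; apply: eq_bigr => j _; rewrite mxE mulrDl.
Qed.

Lemma qfZ (R : realType) (n : nat) (a : R) (A : 'M[R]_n) (v : 'I_n -> R) :
  qf (a *: A) v = a * qf A v.
Proof.
rewrite /qf big_distrr /=; apply: eq_bigr => i _.
by rewrite big_distrr /=; apply: eq_bigr => j _; rewrite mxE -mulrA.
Qed.

Lemma qf_gram (R : realType) (m n : nat) (X : 'M[R]_(m, n)) (v : 'I_n -> R) :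
  qf (X^T *m X) v = \sum_k (\sum_i X k i * v i) ^+ 2.
Proof.
transitivity (\sum_i \sum_j \sum_k (X k i * v i) * (X k j * v j)).
  apply: eq_bigr => i _; apply: eq_bigr => j _.
  by rewrite !mxE big_distrl /=; apply: eq_bigr => k _; rewrite mxE; ring.
under eq_bigr do rewrite exchange_big /=.
rewrite exchange_big /=; apply: eq_bigr => k _.
rewrite expr2 big_distrl /=; apply: eq_bigr => i _.
by rewrite big_distrr.
Qed.

Lemma qf_outer (R : realType) (n : nat) (u : 'I_n -> R) (v : 'I_n -> R) :
  qf (\matrix_(i, j) (u i * u j)) v = (\sum_i u i * v i) ^+ 2.
Proof.
rewrite expr2 big_distrl /=; apply: eq_bigr => i _.
by rewrite big_distrr /=; apply: eq_bigr => j _; rewrite mxE; ring.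
Qed.

Lemma qf_lift (R : realType) (n : nat) (A : 'M[R]_n.+1) (v : 'I_n.+1 -> R) :
  (forall j, A ord0 j = 0) -> (forall i, A i ord0 = 0) ->
  qf A v = qf (\matrix_(i, j) A (lift ord0 i) (lift ord0 j)) (v \o lift ord0).
Proof.
move=> r0 c0; rewrite /qf big_ord_recl big1 ?add0r => [|j _]; last first.
  by rewrite r0 mul0r.
apply: eq_bigr => i _; rewrite big_ord_recl c0 mul0r add0r.
by apply: eq_bigr => j _; rewrite mxE.
Qed.

Lemma qf_pair (R : realType) (n : nat) (A : 'M[R]_n) (a b : 'I_n) (x y : R) :
  qf A (fun i => x * (i == a)%:R + y * (i == b)%:R)
  = x ^+ 2 * A a a + x * y * (A a b + A b a) + y ^+ 2 * A b b.
Proof.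
have pairE (F : 'I_n -> R) :
    \sum_i F i * (x * (i == a)%:R + y * (i == b)%:R) = x * F a + y * F b.
  have oneE c z : \sum_i F i * (z * (i == c)%:R) = z * F c.
    rewrite (bigD1 c) //= big1 => [|i /negPf ->]; last by rewrite !mulr0.
    by rewrite eqxx mulr1 addr0 mulrC.
  by under eq_bigr do rewrite mulrDr; rewrite big_split /= !oneE.
transitivity (\sum_i (x * A i a + y * A i b)
                * (x * (i == a)%:R + y * (i == b)%:R)).
  apply: eq_bigr => i _; rewrite -pairE big_distrl /=.
  by apply: eq_bigr => j _; ring.
by rewrite pairE; ring.
Qed.

Lemma qf_delta0 (R : realType) (n : nat) (A : 'M[R]_n.+1) :
  qf A (fun i => (i == ord0)%:R) = A ord0 ord0.
Proof.
have -> : A ord0 ord0 = 1 ^+ 2 * A ord0 ord0 + 1 * 0 * (A ord0 ord0 + A ord0 ord0)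
   + 0 ^+ 2 * A ord0 ord0 by ring.
by rewrite -qf_pair; apply: eq_qf => // i; rewrite mul1r mul0r addr0.
Qed.

Lemma det_schur (R : realType) (n : nat) (A : 'M[R]_n.+1) :
  A ord0 ord0 != 0 -> \det A = A ord0 ord0 * \det (schur A).
Proof.
move=> a0; pose A' : 'M_(1 + n) := A.
(* Adding [c] times the first row to the other rows clears the first column below the pivot. *)
pose c := - (A ord0 ord0)^-1 *: dlsubmx A'.
have -> : \det A = \det (block_mx 1%:M 0 c 1%:M *m A').
  by rewrite det_mulmx det_lblock !det1 !mul1r.
rewrite -[A' in _ *m A']submxK mulmx_block !mul1mx !mul0mx !addr0.
have -> : c *m ulsubmx A' + dlsubmx A' = 0.
  apply/matrixP => i j; rewrite !mxE big_ord1 !mxE !ord1 !lshift0.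
  by rewrite mulrAC mulNr mulVf// mulN1r addNr.
rewrite det_ublock det_mx11 !mxE lshift0; congr (_ * \det _).
apply/matrixP => i j; rewrite !mxE big_ord1 !mxE !lshift0 !rshift1 addrC.
by congr (_ + _); field.
Qed.

(** Completing the square in coordinate 0. With a zero corner the first row vanishes by hypothesis,
    and [x / 0 = 0] removes the square term. *)
Lemma qf_schur (R : realType) (n : nat) (A : 'M[R]_n.+1) (v : 'I_n.+1 -> R) :
  A^T = A -> (A ord0 ord0 = 0 -> forall j, A ord0 j = 0) ->
  qf A v = (\sum_i A i ord0 * v i) ^+ 2 / A ord0 ord0
           + qf (schur A) (v \o lift ord0).
Proof.
move=> sA dA; pose a := A ord0 ord0.
pose P : 'M[R]_n.+1 := \matrix_(i, j) (A i ord0 * A j ord0).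
have -> : schur A = \matrix_(i, j)
    (A - a^-1 *: P) (lift ord0 i) (lift ord0 j).
  apply/matrixP => i j; rewrite !mxE (sym_mxE (lift ord0 j) _ sA).
  by rewrite mulrC.
have row0 j : (A - a^-1 *: P) ord0 j = 0.
  rewrite !mxE (sym_mxE j _ sA) -/a; have [a0|a0] := eqVneq a 0.
    by rewrite dA// !mulr0 subr0.
  by rewrite mulKf ?subrr.
rewrite -qf_lift //; last first.
  move=> i; rewrite -(row0 i) !mxE (sym_mxE i _ sA).
  by rewrite [A ord0 i * _]mulrC.
by rewrite -qf_outer -/P mulrC -qfZ -qfD addrC subrK.
Qed.

(** Every value of the form of [schur A] is a value of the form of [A], so positivity passes to the
    Schur complement. *)
Lemma qf_schur_ext (R : realType) (n : nat) (A : 'M[R]_n.+1) (w : 'I_n -> R) :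
  A^T = A -> (A ord0 ord0 = 0 -> forall j, A ord0 j = 0) ->
  exists v, (forall i, v (lift ord0 i) = w i) /\ qf A v = qf (schur A) w.
Proof.
(* This first coordinate makes the completed square vanish; with a zero corner that term is 0
   anyway. *)
move=> sA dA; pose x := - (\sum_i A (lift ord0 i) ord0 * w i) / A ord0 ord0.
pose v i := if unlift ord0 i is Some j then w j else x.
have v0 : v ord0 = x by rewrite /v unlift_none.
have vl i : v (lift ord0 i) = w i by rewrite /v liftK.
exists v; split=> //; rewrite (qf_schur _ sA dA).
rewrite big_ord_recl v0; under eq_bigr do rewrite vl.
rewrite (@eq_qf _ _ (schur A) (schur A) (v \o lift ord0) w) //.
have [a0|a0] := eqVneq (A ord0 ord0) 0; first by rewrite a0 invr0 mulr0 add0r.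
by rewrite /x mulrCA mulfV// mulr1 addNr expr0n mul0r add0r.
Qed.

Lemma schur_sym (R : realType) (n : nat) (A : 'M[R]_n.+1) :
  A^T = A -> (schur A)^T = schur A.
Proof.
move=> sA; apply/matrixP => i j; rewrite !mxE.
rewrite (sym_mxE _ (lift ord0 i) sA) [A ord0 (lift ord0 i)](sym_mxE _ _ sA).
by rewrite [A (lift ord0 j) ord0](sym_mxE _ _ sA) [X in X / _]mulrC.
Qed.

(** One step of the Cholesky factorization: [Y] has first row [A ord0 j / s], zeros below its
    corner, and [X] as lower right block. *)
Lemma gram_schur (R : realType) (n : nat) (A : 'M[R]_n.+1) (X : 'M[R]_n) :
  A^T = A -> 0 <= A ord0 ord0 -> (A ord0 ord0 = 0 -> forall j, A ord0 j = 0) ->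
  schur A = X^T *m X -> exists Y : 'M[R]_n.+1, A = Y^T *m Y.
Proof.
move=> sA a_ge0 dA SX; pose a := A ord0 ord0; pose s := Num.sqrt a.
exists (\matrix_(k, j) if unlift ord0 k is Some k' then
          if unlift ord0 j is Some j' then X k' j' else 0
        else A ord0 j / s).
have ss : s * s = a by rewrite -expr2 sqr_sqrtr.
have sE : s^-1 * s^-1 = a^-1 by rewrite -invfM ss.
apply/matrixP => i j; rewrite mxE big_ord_recl !mxE unlift_none.
rewrite mulrACA sE.
have row0 l : A ord0 l = A ord0 ord0 * A ord0 l / a.
  have [a0|a0] := eqVneq a 0; first by rewrite dA// !(mulr0, mul0r).
  by rewrite -/a mulrAC divff// mul1r.
case: (unliftP ord0 i) => [i'|] ->; last first.
  rewrite big1 ?addr0 -?row0 // => k _.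
  by rewrite !mxE liftK unlift_none mul0r.
case: (unliftP ord0 j) => [j'|] ->; last first.
  rewrite big1 ?addr0 => [|k _]; last by rewrite !mxE liftK unlift_none mulr0.
  by rewrite [A ord0 _ * _]mulrC -row0 (sym_mxE _ _ sA).
have : schur A i' j' = (X^T *m X) i' j' by rewrite SX.
rewrite !mxE [A (lift _ _) ord0](sym_mxE _ _ sA) => /(canRL (subrK _)) ->.
rewrite addrC; congr (_ + _); apply: eq_bigr => k _.
by rewrite !mxE !liftK.
Qed.

Lemma psd_schur (R : realType) (n : nat) (A : 'M[R]_n.+1) :
  psd A -> (A ord0 ord0 = 0 -> forall j, A ord0 j = 0) -> psd (schur A).
Proof.
move=> [sA pA] dA; split=> [|w]; first exact: schur_sym.
by have [v [_ <-]] := qf_schur_ext w sA dA; exact: pA.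
Qed.

Lemma psd_gram (R : realType) (n : nat) (A : 'M[R]_n) :
  psd A -> exists X : 'M[R]_n, A = X^T *m X.
Proof.
elim: n A => [|n IH] A [sA pA].
  by exists 0; apply/matrixP => -[].
have a_ge0 : 0 <= A ord0 ord0. by rewrite -qf_delta0.
have dA : A ord0 ord0 = 0 -> forall j, A ord0 j = 0.
  move=> a0 j; apply/eqP/negP => /negP b0.
  (* With a zero corner the form at x e_0 + e_j is affine in [x], so its slope must vanish;
     otherwise the [x] chosen below gives the value -1. *)
  have lin x : 0 <= x * (2 * A ord0 j) + A j j.
    have -> : x * (2 * A ord0 j) + A j j
        = qf A (fun i => x * (i == ord0)%:R + 1 * (i == j)%:R).
      by rewrite qf_pair a0 (sym_mxE j _ sA); ring.
    exact: pA.
  have := lin (- (A j j + 1) / (2 * A ord0 j)); rewrite divfK.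
    by rewrite opprD addrAC addNr add0r oppr_ge0 ler10.
  by rewrite mulf_neq0 ?pnatr_eq0.
by have [//|X SX] := IH (schur A) (psd_schur _ dA); exact: gram_schur SX.
Qed.

(** Induction on Schur complements: a principal minor of [schur A] is a principal minor of [A]
    through index 0, divided by the corner. With a zero corner, [schur A] is the lower right
    block. *)
Lemma gram_of_minors (R : realType) (n : nat) (A : 'M[R]_n) :
  A^T = A ->
  (forall k (f : 'I_k -> 'I_n), increasing f -> 0 <= \det (mxsub f f A)) ->
  exists X : 'M[R]_n, A = X^T *m X.
Proof.
elim: n A => [|n IH] A sA mA.
  by exists 0; apply/matrixP => -[].
have a_ge0 : 0 <= A ord0 ord0.
  have := mA 1 (fun=> ord0); rewrite det_mx11 mxE; apply.
  by move=> i j; rewrite !ord1.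
have dA : A ord0 ord0 = 0 -> forall j, A ord0 j = 0.
  move=> a0 j; case: (unliftP ord0 j) => [j'|] -> //.
  (* With a zero corner, the principal minor on these two indices is minus a square. *)
  pose f (i : 'I_2) := if i == ord0 then ord0 else lift ord0 j'.
  have /mA : increasing f.
    by move=> i i'; rewrite /f; case: i => [[|[|?]]]; case: i' => [[|[|?]]].
  rewrite (expand_det_row _ ord0) !big_ord_recl big_ord0 /cofactor !det_mx11.
  rewrite !mxE /f /= a0 mul0r add0r addr0 expr1 mulN1r mulrN.
  rewrite (sym_mxE _ ord0 sA) -expr2.
  rewrite oppr_ge0 => le0; apply/eqP; rewrite -sqrf_eq0.
  by rewrite eq_le le0 sqr_ge0.
have [|k f fi|X SX] := IH (schur A); last exact: gram_schur SX.
  exact: schur_sym.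
have [a0|a0] := eqVneq (A ord0 ord0) 0.
  have -> : mxsub f f (schur A) = mxsub (lift ord0 \o f) (lift ord0 \o f) A.
    by apply/matrixP => i j; rewrite !mxE a0 invr0 mulr0 subr0.
  by apply: mA => i j /fi; rewrite /= /bump /= ltnS.
pose g (i : 'I_k.+1) := if unlift ord0 i is Some j then lift ord0 (f j) else ord0.
have /mA : increasing g.
  move=> i j; rewrite /g; case: (unliftP ord0 i) => [i'|] ->;
    case: (unliftP ord0 j) => [j'|] -> //=.
  by rewrite /bump /= !add1n !ltnS; apply: fi.
have g0 : g ord0 = ord0 by rewrite /g unlift_none.
have gl i : g (lift ord0 i) = lift ord0 (f i) by rewrite /g liftK.
rewrite det_schur mxE g0 // pmulr_rge0 ?lt0r ?a0 //.
suff -> : schur (mxsub g g A) = mxsub f f (schur A) by [].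
by apply/matrixP => i j; rewrite !mxE g0 !gl.
Qed.

(** * Definiteness, determinants and the Schur product theorem *)

Lemma gram_psd (R : realType) (m n : nat) (X : 'M[R]_(m, n)) : psd (X^T *m X).
Proof.
split=> [|v]; first by rewrite trmx_mul trmxK.
by rewrite qf_gram; apply: sumr_ge0 => k _; apply: sqr_ge0.
Qed.

Lemma pd_psd (R : realType) (n : nat) (A : 'M[R]_n) : pd A -> psd A.
Proof.
move=> [sA pA]; split=> // v.
have [/existsP/pA/ltW//|/existsPn v0] := boolP [exists i, v i != 0].
rewrite /qf big1 // => i _; rewrite big1 // => j _.
by have /negPn/eqP -> := v0 i; rewrite mul0r mulr0.
Qed.

(** A Gram factorization makes the determinant a square, and a kernel vector would annihilate the
    form. *)
Lemma pd_det_gt0 (R : realType) (n : nat) (A : 'M[R]_n) : pd A -> 0 < \det A.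
Proof.
move=> pA; have [X AX] := psd_gram (pd_psd pA).
rewrite lt0r {2}AX det_mulmx det_tr -expr2 sqr_ge0 andbT.
apply/det0P => -[v /rV0Pn vn0 vA]; have := pA.2 (v ord0) vn0.
rewrite /qf exchange_big big1 ?ltxx //= => j _.
have := congr1 (fun M : 'M_(_, _) => M ord0 j) vA; rewrite !mxE => sum0.
under eq_bigr do rewrite mulrA [A _ _ * _]mulrC.
by rewrite -big_distrl /= sum0 mul0r.
Qed.

Lemma gram_pd (R : realType) (n : nat) (X : 'M[R]_n) :
  \det (X^T *m X) != 0 -> pd (X^T *m X).
Proof.
rewrite det_mulmx det_tr mulf_eq0 orbb -unitfE -[_ \is a _]/(X \in unitmx) => uX.
split=> [|v [i vi]]; first by have [] := gram_psd X.
rewrite lt0r (gram_psd X).2 andbT qf_gram psumr_eq0 => [|k _]; last exact: sqr_ge0.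
apply: contra vi => /allP X0; apply/eqP.
have : X *m (\col_i v i) = 0.
  apply/matrixP => k l; rewrite !mxE.
  have := X0 k (mem_index_enum k); rewrite /= sqrf_eq0 => /eqP X0k.
  by rewrite -[RHS]X0k; apply: eq_bigr => j _; rewrite mxE.
move/(congr1 (mulmx (invmx X))); rewrite mulKmx // mulmx0.
by move/matrixP/(_ i ord0); rewrite !mxE.
Qed.

(** The core of the Schur product theorem: each row of [X] contributes the form of [B] at a rescaled
    vector. *)
Lemma qf_hadamard_gram (R : realType) (m n : nat) (B : 'M[R]_n)
    (X : 'M[R]_(m, n)) (v : 'I_n -> R) :
  qf (\matrix_(i, j) (B i j * (X^T *m X) i j)) v
  = \sum_k qf B (fun i => X k i * v i).
Proof.
rewrite /qf [RHS]exchange_big /=; apply: eq_bigr => i _.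
rewrite [RHS]exchange_big /=; apply: eq_bigr => j _.
rewrite !mxE big_distrr big_distrl /=; apply: eq_bigr => k _.
by rewrite mxE; ring.
Qed.

Lemma psd_hadamard (R : realType) (n : nat) (B C : 'M[R]_n) (v : 'I_n -> R) :
  psd B -> psd C -> 0 <= qf (\matrix_(i, j) (B i j * C i j)) v.
Proof.
move=> pB /psd_gram[X ->]; rewrite qf_hadamard_gram.
by apply: sumr_ge0 => k _; apply: pB.2.
Qed.

(** Strictness: [C i i] is the sum of the squares of [X k i], so where [v i] is nonzero some row of
    [X] rescales [v] to a nonzero vector. *)
Lemma pd_hadamard (R : realType) (n : nat) (B C : 'M[R]_n) (v : 'I_n -> R) :
  pd B -> psd C -> (forall i, 0 < C i i) -> (exists i, v i != 0) ->
  0 < qf (\matrix_(i, j) (B i j * C i j)) v.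
Proof.
move=> pB pC dC [i vi]; rewrite lt0r psd_hadamard ?andbT //; last exact: pd_psd.
have [X CX] := psd_gram pC; move: (dC i); rewrite CX qf_hadamard_gram.
rewrite psumr_eq0 => [|k _]; last exact: (pd_psd pB).2.
rewrite mxE => dCi; apply/negP => /allP q0.
move: dCi; rewrite big1 ?ltxx // => k _.
have [Xki|Xki] := eqVneq (X k i) 0; first by rewrite Xki mulr0.
have := q0 k (mem_index_enum k); rewrite /= gt_eqF //.
by apply: pB.2; exists i; rewrite mulf_neq0.
Qed.

(** * Entrywise powers of positive definite matrices *)

Lemma is_derive_affine_powR (R : realType) (p s k t x : R) :
  0 < p + x * s ->
  is_derive x 1 (fun y : R => (p + y * s) `^ t * k)
    (t * (s * (p + x * s) `^ (t - 1) * k)).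
Proof.
move=> ps0.
have dl : is_derive x 1 (fun y : R => p + y * s) s.
  by apply: is_derive_eq; rewrite scaler0 !add0r mul1r /GRing.scale /= mulr1.
have dp := @is_derive1_comp R (fun y => y `^ t) _ x _ _ (is_derive1_powR t ps0) dl.
apply: is_derive_eq; rewrite scaler0 add0r /GRing.scale /=; ring.
Qed.

Lemma is_derive_sumE (R : realType) (n : nat) (h : 'I_n -> R -> R) (x : R)
    (dh : 'I_n -> R) :
  (forall i, is_derive x 1 (h i) (dh i)) ->
  is_derive x 1 (fun y => \sum_i h i y) (\sum_i dh i).
Proof.
move=> /is_derive_sum; suff -> : \sum_i h i = (fun y => \sum_i h i y) by [].
by apply/funext => y; rewrite fct_sumE.
Qed.

(** Fixing [v] reduces the claim to the mean value theorem for a real function on [0, 1]; hence [c]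
    depends on [v]. *)
Lemma hadamard_power_mvt (R : realType) (n : nat) (P S : 'M[R]_n)
    (v : 'I_n -> R) (t : R) :
  (forall i j, 0 < P i j) -> (forall i j, 0 < (P + S) i j) ->
  exists c, [/\ 0 < c < 1, forall i j, 0 < (P + c *: S) i j &
    qf (hadamard_power (P + S) t) v = qf (hadamard_power P t) v
      + t * qf (\matrix_(i, j) (S i j * hadamard_power (P + c *: S) (t - 1) i j)) v].
Proof.
move=> P0 PS0.
(* Entries stay positive on the whole segment by convexity, so the power is differentiable there. *)
have pos (x : R) i j : 0 <= x <= 1 -> 0 < P i j + x * S i j.
  move=> /andP[x0 x1].
  have -> : P i j + x * S i j = (1 - x) * P i j + x * (P + S) i j.
    by rewrite mxE; ring.
  move: x0; rewrite le_eqVlt => /predU1P[<-|x0].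
    by rewrite subr0 mul1r mul0r addr0.
  by rewrite ltr_wpDl ?mulr_gt0// mulr_ge0 ?subr_ge0// ltW.
pose f (x : R) := \sum_i \sum_j (P i j + x * S i j) `^ t * (v i * v j).
pose df (x : R) := \sum_i \sum_j
  t * (S i j * (P i j + x * S i j) `^ (t - 1) * (v i * v j)).
have drv (x : R) : 0 <= x <= 1 -> is_derive x 1 f (df x).
  move=> x01; apply: is_derive_sumE => i; apply: is_derive_sumE => j.
  exact/is_derive_affine_powR/pos.
have [|x||c /[!in_itv]/= c01] := @MVT R f df 0 1; first exact: ltr01.
- by rewrite in_itv /= => /andP[/ltW x0 /ltW x1]; apply: drv; rewrite x0.
- by apply: derivable_within_continuous => x /[!in_itv]/= /drv dx; exact: ex_derive.
rewrite subr0 mulr1 => /(canRL (subrK _)) ff.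
exists c; split=> //.
  by move=> i j; rewrite !mxE pos//; case/andP: c01 => /ltW -> /ltW ->.
have -> : qf (hadamard_power (P + S) t) v = f 1.
  by apply: eq_bigr => i _; apply: eq_bigr => j _; rewrite !mxE mul1r.
rewrite ff addrC; congr (_ + _).
  by apply: eq_bigr => i _; apply: eq_bigr => j _; rewrite !mxE mul0r addr0.
rewrite /qf big_distrr; apply: eq_bigr => i _ /=.
by rewrite big_distrr; apply: eq_bigr => j _ /=; rewrite !mxE.
Qed.

(** The power of the rank one matrix [P] yields the square, and [A - P] lives on the block
    [schur A]. [C] is the corresponding block of the intermediate point and depends on [v]. *)
Lemma hadamard_power_schur (R : realType) (n : nat) (A : 'M[R]_n.+1)
    (v : 'I_n.+1 -> R) (t : R) :
  A^T = A -> (forall i j, 0 < A i j) ->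
  exists C : 'M[R]_n, [/\ forall i j, 0 < C i j, psd (schur A) -> psd C &
    qf (hadamard_power A t) v
    = (\sum_i A i ord0 `^ t * v i) ^+ 2 / A ord0 ord0 `^ t
      + t * qf (\matrix_(i, j) (schur A i j * hadamard_power C (t - 1) i j))
              (v \o lift ord0)].
Proof.
move=> sA A0; set a := A ord0 ord0.
have a0 : 0 < a by apply: A0.
pose P : 'M[R]_n.+1 := \matrix_(i, j) (A i ord0 * A j ord0 / a).
have P0 i j : 0 < P i j by rewrite mxE divr_gt0 ?mulr_gt0.
have PSE : P + (A - P) = A by rewrite addrC subrK.
have [|c [/andP[c0 _] C0]] := @hadamard_power_mvt R n.+1 P (A - P) v t P0.
  by rewrite PSE.
rewrite PSE => ->.
have SE i j : schur A i j = (A - P) (lift ord0 i) (lift ord0 j).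
  by rewrite !mxE (sym_mxE ord0 _ sA).
have row0 j : (A - P) ord0 j = 0.
  by rewrite !mxE (sym_mxE ord0 _ sA) -/a mulrAC divff ?gt_eqF// mul1r subrr.
have sP : P^T = P by apply/matrixP => i j; rewrite !mxE [_ * A j _]mulrC.
have col0 i : (A - P) i ord0 = 0.
  by rewrite sym_mxE ?row0// linearB /= sA sP.
pose C : 'M[R]_n :=
  \matrix_(i, j) (P + c *: (A - P)) (lift ord0 i) (lift ord0 j).
(* A rank one square plus a positive multiple of [schur A]: this makes [C] semidefinite whenever
   [schur A] is. *)
have CE : C = a^-1 *: (\matrix_(i, j) (A (lift ord0 i) ord0 * A (lift ord0 j) ord0))
              + c *: schur A.
  apply/matrixP => i j; rewrite !mxE; congr (_ + _); first exact: mulrC.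
  by rewrite (sym_mxE ord0 _ sA).
exists C; split=> [i j|[sS pS]|].
- by rewrite mxE.
- split=> [|w]; last first.
    rewrite CE qfD !qfZ qf_outer; apply: addr_ge0.
      by rewrite mulr_ge0 ?sqr_ge0 // invr_ge0 ltW.
    by rewrite mulr_ge0 ?pS // ltW.
  rewrite CE linearD !linearZ /= sS; congr (_ *: _ + _).
  by apply/matrixP => i j; rewrite !mxE mulrC.
- congr (_ + _ * _).
    rewrite [RHS]mulrC -qf_outer -qfZ; apply: eq_qf => // i j; rewrite !mxE.
    rewrite powRM ?mulr_ge0 ?invr_ge0 ?ltW// powRM ?ltW// mulrC; congr (_ * _).
    by rewrite -powR_inv1 ?ltW// -powRrM mulN1r powRN.
  rewrite qf_lift.
  - apply: eq_qf => // i j; rewrite [RHS]mxE SE [LHS]mxE [LHS]mxE.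
    by congr (_ * _); rewrite !mxE.
  - by move=> j; rewrite mxE row0 mul0r.
  - by move=> i; rewrite mxE col0 mul0r.
Qed.

Lemma pd_schur (R : realType) (n : nat) (A : 'M[R]_n.+1) : pd A -> pd (schur A).
Proof.
move=> pA; have [sA pAv] := pA; split=> [|w [i wi]]; first exact: schur_sym.
have a0 : 0 < A ord0 ord0.
  by rewrite -qf_delta0; apply: pAv; exists ord0; rewrite eqxx oner_neq0.
have [|v [vl <-]] := qf_schur_ext w sA; first by move=> a00; rewrite a00 ltxx in a0.
by apply: pAv; exists (lift ord0 i); rewrite vl.
Qed.

(** The size is [n.+1], so the bound on [t] is the size minus 2. Passing to the Schur complement
    lowers size and exponent by one each. *)
Lemma psd_hadamard_power (R : realType) (n : nat) (A : 'M[R]_n.+1) (t : R) :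
  psd A -> (forall i j, 0 < A i j) -> n%:R - 1 <= t ->
  psd (hadamard_power A t).
Proof.
elim: n A t => [|n IH] A t pA A0 nt; (split=> [|v]; first by
  apply/matrixP => i j; rewrite !mxE (sym_mxE i j pA.1)).
all: have [C [C0 pC ->]] := hadamard_power_schur v t pA.1 A0.
all: apply: addr_ge0; first by rewrite divr_ge0 ?sqr_ge0 ?powR_ge0.
  by rewrite /qf big_ord0 mulr0.
rewrite -natr1 addrK in nt.
have pS : psd (schur A).
  by apply: psd_schur pA _ => a0; have := A0 ord0 ord0; rewrite a0 ltxx.
rewrite mulr_ge0 ?psd_hadamard ?(le_trans _ nt)//.
by apply: IH; rewrite ?lerB//; exact: pC.
Qed.

(** If [v] is nonzero beyond coordinate 0, the Schur product term is positive; otherwise the square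
    is. At size 2 the first bound admits [t = 0], whose power is the singular all-ones matrix;
    [0 < t] excludes it. *)
Lemma pd_hadamard_power (R : realType) (n : nat) (A : 'M[R]_n.+1) (t : R) :
  pd A -> (forall i j, 0 < A i j) -> n%:R - 1 <= t -> 0 < t ->
  pd (hadamard_power A t).
Proof.
move=> pA A0 nt t0; split=> [|v [i0 vi0]].
  by apply/matrixP => i j; rewrite !mxE (sym_mxE i j pA.1).
have [C [C0 pC ->]] := hadamard_power_schur v t pA.1 A0.
have pS := pd_schur pA.
have [/existsP[i vi]|/existsPn vl] := boolP [exists i, v (lift ord0 i) != 0].
  case: n => [|n] in A v i0 vi0 pA A0 nt C C0 pC pS i vi *; first by case: i vi.
  rewrite -natr1 addrK in nt.
  apply: ltr_wpDl; first by rewrite divr_ge0 ?sqr_ge0 ?powR_ge0.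
  rewrite mulr_gt0 ?pd_hadamard //; last by exists i.
    apply: psd_hadamard_power; rewrite ?lerB//; exact/pC/pd_psd.
  by move=> j; rewrite mxE powR_gt0.
have vl0 i : v (lift ord0 i) = 0 by apply/eqP/negPn/vl.
apply: ltr_pwDl.
  rewrite divr_gt0 ?powR_gt0// big_ord_recl big1 => [|i _]; last first.
    by rewrite vl0 mulr0.
  rewrite addr0 exprn_even_gt0//=; apply: mulf_neq0; first by rewrite gt_eqF ?powR_gt0.
  by case: (unliftP ord0 i0) vi0 => [j|] ->; rewrite ?vl0 ?eqxx.
apply: mulr_ge0; first exact: ltW.
rewrite /qf big1 // => i _; rewrite big1 // => j _.
by rewrite /= vl0 mul0r mulr0.
Qed.

(** * Fekete's criterion *)

(** Multilinearity in the rows: [f] chooses one summand in each row. *)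
Lemma det_row_sums (R : comRingType) (k m : nat) (Q : 'I_k -> pred 'I_m)
    (B : 'I_m -> 'I_k -> R) :
  \det (\matrix_(i < k, j < k) \sum_(p | Q i p) B p j)
  = \sum_(f in family Q) \det (\matrix_(i < k, j < k) B (f i) j).
Proof.
rewrite exchange_big /=; apply: eq_bigr => s _.
under eq_bigr do rewrite mxE.
rewrite bigA_distr_big_dep big_distrr /=; apply: eq_bigr => f _.
by congr (_ * _); apply: eq_bigr => i _; rewrite mxE.
Qed.

(** Dividing each row by its first entry makes the first column all ones. The Schur complement then
    holds differences with row 0, which telescope into consecutive differences. *)
Lemma det_consecutive_differences (R : realType) (k : nat) (U : nat -> nat -> R) :
  (forall i : 'I_k.+1, U i 0 != 0) ->
  \det (\matrix_(i < k.+1, j < k.+1) U i j)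
  = (\prod_(i < k.+1) U i 0)
    * \det (\matrix_(i < k, j < k)
              (U i.+1 j.+1 / U i.+1 0 - U i j.+1 / U i 0)).
Proof.
move=> U0; pose N : 'M[R]_k.+1 := \matrix_(i, j) (U i j / U i 0).
pose d : 'rV[R]_k.+1 := \row_i U i 0.
have -> : \matrix_(i < k.+1, j < k.+1) U i j = diag_mx d *m N.
  by apply/matrixP => i j; rewrite mul_diag_mx !mxE mulrC divfK.
rewrite det_mulmx det_diag; congr (_ * _).
  by apply: eq_bigr => i _; rewrite mxE.
have N0 i : N i ord0 = 1 by rewrite mxE divff.
rewrite det_schur N0 ?oner_neq0// mul1r.
set D := (X in _ = \det X).
(* Partial summation as a unit lower triangular matrix. *)
pose T : 'M[R]_k := \matrix_(i, l) (l <= i)%:R.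
suff -> : schur N = T *m D.
  rewrite det_mulmx det_trig.
    by rewrite big1 ?mul1r // => i _; rewrite mxE leqnn.
  by apply/is_trig_mxP => i j ij; rewrite mxE leqNgt ij.
apply/matrixP => i j; rewrite mxE [RHS]mxE !N0 mul1r divr1 !mxE !lift0.
pose w l := U l j.+1 / U l 0.
rewrite -[LHS]/(w i.+1 - w 0) -(telescope_sumr w (leq0n _)) big_mkord.
rewrite (big_ord_widen k (fun l => w l.+1 - w l)) // big_mkcond /=.
by apply: eq_bigr => l _; rewrite !mxE ltnS; case: leqP; rewrite ?mul1r ?mul0r.
Qed.

(* After scaling the first column to ones, consecutive row differences [B] have
   the same kind of contiguous minors with one column less, and a row difference
   of the minor on the rows [f i] is a sum of rows of [B]; multilinearity writes
   this minor as a positive combination of minors of [B]. *)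
Lemma fekete_rows (R : realType) (k m : nat) (A : nat -> nat -> R) :
  (forall l p, (l <= k)%N -> (p + l <= m)%N ->
     0 < \det (\matrix_(i < l, j < l) A (p + i)%N j)) ->
  forall f : 'I_k -> nat,
  (forall i j : 'I_k, (i < j)%N -> (f i < f j)%N) -> (forall i, (f i < m)%N) ->
  0 < \det (\matrix_(i < k, j < k) A (f i) j).
Proof.
elim: k m A => [|k IH] m A mA f fi fm; first by rewrite det_mx00.
have A0 p : (p < m)%N -> 0 < A p 0%N.
  by move=> pm; have := mA 1%N p; rewrite det_mx11 mxE addn0 addn1; exact.
case: m => [|m] in mA fm A0 *; first by have := fm ord0.
pose B p j := A p.+1 j.+1 / A p.+1 0%N - A p j.+1 / A p 0%N.
have mB l p : (l <= k)%N -> (p + l <= m)%N ->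
    0 < \det (\matrix_(i < l, j < l) B (p + i)%N j).
  move=> lk plm; have := mA l.+1 p lk; rewrite addnS => /(_ plm).
  have pm (i : 'I_l.+1) : (p + i < m.+1)%N.
    by rewrite ltnS (leq_trans _ plm)// leq_add2l -ltnS.
  rewrite (det_consecutive_differences (U := fun i => A (p + i)%N)) => [|i].
    rewrite pmulr_rgt0; last by apply: prodr_gt0 => i _; exact/A0/pm.
    suff -> : \matrix_(i < l, j < l) B (p + i)%N j = \matrix_(i < l, j < l)
        (A (p + i.+1)%N j.+1 / A (p + i.+1)%N 0%N
         - A (p + i)%N j.+1 / A (p + i)%N 0%N) by [].
    by apply/matrixP => i j; rewrite !mxE /B addnS.
  by rewrite gt_eqF // A0.
pose g i := f (inord i).
have -> : \matrix_(i < k.+1, j < k.+1) A (f i) j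
    = \matrix_(i < k.+1, j < k.+1) A (g i) j.
  by apply/matrixP => i j; rewrite !mxE /g inord_val.
have gm i : (g i < m.+1)%N by exact: fm.
have gle i j : (i <= j)%N -> (j <= k)%N -> (g i <= g j)%N.
  move=> + jk; rewrite leq_eqVlt => /predU1P[->//|ij].
  by apply/ltnW/fi; rewrite !inordK // ltnS // (leq_trans (ltnW ij)).
have glt i : (i < k)%N -> (g i < g i.+1)%N.
  by move=> ik; apply: fi; rewrite !inordK // ltnS // ltnW.
rewrite (det_consecutive_differences (U := fun i => A (g i))) => [|i]; last first.
  by rewrite gt_eqF // A0.
rewrite mulr_gt0 //; first by apply: prodr_gt0 => i _; exact/A0/gm.
(* The difference of rows [g i.+1] and [g i] telescopes over this interval. The intervals are
   disjoint and ordered, so every choice of one index in each is increasing. *)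
pose Q (i : 'I_k) : pred 'I_m := fun p => (g i <= p < g i.+1)%N.
set M := (X in \det X).
have -> : M = \matrix_(i < k, j < k) \sum_(p | Q i p) B p j.
  apply/matrixP => i j; rewrite !mxE.
  pose w p := A p j.+1 / A p 0%N.
  have gi : (g i <= g i.+1)%N by apply/ltnW/glt.
  rewrite -[LHS]/(w (g i.+1) - w (g i)) -(telescope_sumr w gi).
  rewrite big_geq_mkord (big_ord_widen_cond m (fun p => g i <= p)%N
    (fun p => w p.+1 - w p)) //.
  by rewrite -ltnS gm.
rewrite det_row_sums.
have h_pos (h : {ffun 'I_k -> 'I_m}) : h \in family Q ->
    0 < \det (\matrix_(i < k, j < k) B (h i) j).
  move=> /familyP hQ; apply: (IH m B mB (fun i => h i)) => // i j ij.
  have /andP[_ hi] := hQ i; have /andP[hj _] := hQ j.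
  by apply: leq_trans hi (leq_trans (gle _ _ _ _) hj); rewrite // ltnW.
have gm' (i : 'I_k) : (g i < m)%N by rewrite -ltnS (leq_ltn_trans (glt i _))// gm.
(* The left endpoints form one admissible choice, so the sum of positive minors is not empty. *)
pose h0 : {ffun 'I_k -> 'I_m} := [ffun i => Ordinal (gm' i)].
have h0Q : h0 \in family Q by apply/familyP => i; rewrite ffunE unfold_in /= leqnn glt.
rewrite (bigD1 h0) //= ltr_pwDl ?h_pos//.
by apply: sumr_ge0 => h /andP[/h_pos/ltW].
Qed.

(** The row criterion is applied twice: to the transpose, reducing to contiguous columns, and then
    to the rows of each such column block. *)
Lemma fekete (R : realType) (r m n : nat) (A : nat -> nat -> R) :
  (forall l p q, (l <= r)%N -> (p + l <= m)%N -> (q + l <= n)%N ->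
     0 < \det (\matrix_(i < l, j < l) A (p + i)%N (q + j)%N)) ->
  forall k (f g : 'I_k -> nat), (k <= r)%N ->
  (forall i j : 'I_k, (i < j)%N -> (f i < f j)%N) -> (forall i, (f i < m)%N) ->
  (forall i j : 'I_k, (i < j)%N -> (g i < g j)%N) -> (forall i, (g i < n)%N) ->
  0 < \det (\matrix_(i < k, j < k) A (f i) (g j)).
Proof.
move=> mA [|k] f g kr fi fm gi gn; first by rewrite det_mx00.
have -> : \matrix_(i < k.+1, j < k.+1) A (f i) (g j)
    = (\matrix_(i < k.+1, j < k.+1) A (f (inord j)) (g i))^T.
  by apply/matrixP => i j; rewrite !mxE inord_val.
rewrite det_tr.
apply: (@fekete_rows R k.+1 n (fun i j => A (f (inord j)) i)) => // l q lk qn.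
have -> : \matrix_(i < l, j < l) A (f (inord j)) (q + i)%N
    = (\matrix_(i < l, j < l) A (f (inord i)) (q + j)%N)^T.
  by apply/matrixP => i j; rewrite !mxE.
rewrite det_tr.
apply: (@fekete_rows R l m (fun i j => A i (q + j)%N) _ (fun i => f (inord i))) => //.
  move=> l' p l'l pm; apply: mA => //.
    by rewrite (leq_trans l'l) // (leq_trans lk).
  by rewrite (leq_trans _ qn) // leq_add2l.
move=> i j ij; apply: fi; rewrite !inordK //; exact: leq_trans lk.
Qed.

(** * Hankel matrices *)

Lemma hankel_seq (R : realType) (n : nat) (A : 'M[R]_n) :
  hankel A -> exists h : nat -> R, forall i j : 'I_n, A i j = h (i + j)%N.
Proof.
case: n A => [|n] A hA; first by exists (fun=> 0) => -[].
(* Each [s <= n + n] is the sum of the valid indices [minn s n] and [s - minn s n]. *)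
exists (fun s => A (inord (minn s n)) (inord (s - minn s n))) => i j.
apply: hA; have := ltn_ord i; have := ltn_ord j; rewrite !ltnS => jn in_.
rewrite !inordK ?ltnS ?geq_minr ?subnKC ?geq_minl//.
by case: (leqP (i + j) n) => [|_]; rewrite ?subnn// leq_subLR leq_add.
Qed.

Lemma TP_TN (R : realType) (r n : nat) (A : 'M[R]_n) : TP r A -> TN r A.
Proof. by move=> A_TP k f g kr fi gi; apply/ltW/A_TP. Qed.

(** Built from a total sequence [h], so that the offsets [p] and [q] carry no bounds; bounds enter
    only when the block is compared with [A]. *)
Definition contiguous (R : realType) (h : nat -> R) (k p q : nat) : 'M[R]_k :=
  \matrix_(i, j) h (p + i + (q + j))%N.

Lemma contiguous_sym (R : realType) (h : nat -> R) (k p q : nat) :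
  (contiguous h k p q)^T = contiguous h k p q.
Proof.
by apply/matrixP => i j; rewrite !mxE addnACA [(j + i)%N]addnC -addnACA.
Qed.

Lemma mxsub_contiguous (R : realType) (n : nat) (A : 'M[R]_n) (h : nat -> R)
    (k p q m : nat) (f g : 'I_m -> 'I_k) :
  (forall i j, A i j = h (i + j)%N) -> (p + k <= n)%N -> (q + k <= n)%N ->
  increasing f -> increasing g ->
  exists f' g' : 'I_m -> 'I_n, [/\ increasing f', increasing g' &
    mxsub f g (contiguous h k p q) = mxsub f' g' A].
Proof.
move=> Ah pk qk fi gi.
have lt_shift s (x : 'I_k) : (s + k <= n)%N -> (s + x < n)%N.
  by apply: leq_trans; rewrite ltn_add2l.
exists (fun i => Ordinal (lt_shift p (f i) pk)).
exists (fun i => Ordinal (lt_shift q (g i) qk)).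
split=> [i j /fi|i j /gi|]; rewrite /= ?ltn_add2l //.
by apply/matrixP => i j; rewrite !mxE Ah.
Qed.

Lemma TN_contiguous_gram (R : realType) (r n : nat) (A : 'M[R]_n)
    (h : nat -> R) (k p q : nat) :
  (forall i j, A i j = h (i + j)%N) -> TN r A ->
  (k <= r)%N -> (p + k <= n)%N -> (q + k <= n)%N ->
  exists X : 'M[R]_k, contiguous h k p q = X^T *m X.
Proof.
move=> Ah A_TN kr pk qk; apply: gram_of_minors => [|m f fi].
  exact: contiguous_sym.
have [f' [g' [fi' gi' ->]]] := mxsub_contiguous Ah pk qk fi fi.
apply: A_TN => //; apply: leq_trans kr.
(* Injectivity bounds the size of the minor by [k], hence by [r]. *)
have f_inj : injective f.
  move=> i j fij; apply/val_inj.
  by case: (ltngtP i j) => // /fi; rewrite fij ltnn.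
by have := leq_card f f_inj; rewrite !card_ord.
Qed.

(** Nonnegative principal minors give a Gram factorization, and the positive determinant of the
    block makes its factor invertible. *)
Lemma TP_contiguous_pd (R : realType) (r n : nat) (A : 'M[R]_n)
    (h : nat -> R) (k p q : nat) :
  (forall i j, A i j = h (i + j)%N) -> TP r A ->
  (k <= r)%N -> (p + k <= n)%N -> (q + k <= n)%N -> pd (contiguous h k p q).
Proof.
move=> Ah A_TP kr pk qk.
have idi : increasing (@id 'I_k) by [].
have [f [g [fi gi fg]]] := mxsub_contiguous Ah pk qk idi idi.
have d0 : 0 < \det (contiguous h k p q).
  have -> : contiguous h k p q = mxsub id id (contiguous h k p q).
    by apply/matrixP => i j; rewrite [RHS]mxE.
  by rewrite fg; apply: A_TP.
have [X XE] := TN_contiguous_gram Ah (TP_TN A_TP) kr pk qk.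
by rewrite XE in d0 *; apply: gram_pd; rewrite gt_eqF.
Qed.

Lemma contiguous_pd_TP (R : realType) (r n : nat) (A : 'M[R]_n)
    (h : nat -> R) (t : R) :
  (0 < r)%N -> r%:R - 2 <= t -> 0 < t -> (forall i j, A i j = h (i + j)%N) ->
  (forall k p q, (k <= r)%N -> (p + k <= n)%N -> (q + k <= n)%N ->
     pd (contiguous h k p q)) ->
  TP r (hadamard_power A t).
Proof.
move=> r0 rt t0 Ah hpd k f g kr fi gi.
have -> : mxsub f g (hadamard_power A t)
    = \matrix_(i < k, j < k) h (f i + g j)%N `^ t.
  by apply/matrixP => i j; rewrite !mxE Ah.
apply: (@fekete R r n n (fun i j => h (i + j)%N `^ t) _ k f g) => //.
move=> [|l] p q lr pl ql; first by rewrite det_mx00.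
have -> : \matrix_(i < l.+1, j < l.+1) h (p + i + (q + j))%N `^ t
    = hadamard_power (contiguous h l.+1 p q) t.
  by apply/matrixP => i j; rewrite !mxE.
apply/pd_det_gt0/pd_hadamard_power => // [|i j|]; first exact: hpd.
  have lt_shift s (x : 'I_l.+1) : (s + l.+1 <= n)%N -> (s + x + 1 <= n)%N.
    by apply: leq_trans; rewrite addn1 -addnS leq_add2l.
  (* Positivity of the entries is the case of blocks of size 1. *)
  have := pd_det_gt0 (hpd 1%N _ _ r0 (lt_shift _ i pl) (lt_shift _ j ql)).
  by rewrite det_mx11 !mxE !addn0.
apply: le_trans rt; rewrite lerBrDr.
have -> : l%:R - 1 + 2 = l.+1%:R :> R by rewrite -natr1; ring.
by rewrite ler_nat.
Qed.

(** * Perturbation by power sums and passage to the limit *)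

Definition power_sums (R : realType) (n s : nat) : R :=
  \sum_(l < n) l.+1%:R ^+ s.

(** The block is the Gram matrix of a weighted Vandermonde matrix. A kernel vector is a polynomial
    of degree less than [k] vanishing at [n >= k] distinct points. *)
Lemma power_sums_pd (R : realType) (n k p q : nat) :
  (k <= n)%N -> pd (contiguous (@power_sums R n) k p q).
Proof.
move=> kn; split=> [|v [i vi]]; first exact: contiguous_sym.
pose x (l : 'I_n) : R := l.+1%:R.
have x0 l : 0 < x l by rewrite ltr0n.
(* This weight absorbs the offset [p + q] of the block. *)
pose s (l : 'I_n) := Num.sqrt (x l ^+ (p + q)).
pose X := \matrix_(l < n, i < k) (s l * x l ^+ i).
have -> : contiguous (power_sums R n) k p q = X^T *m X.
  apply/matrixP => a b; rewrite !mxE; apply: eq_bigr => l _; rewrite !mxE.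
  rewrite mulrACA -expr2 sqr_sqrtr ?exprn_ge0 ?ltW// -!exprD.
  by rewrite addnACA.
rewrite qf_gram lt0r; apply/andP; split; last first.
  by apply: sumr_ge0 => l _; apply: sqr_ge0.
rewrite psumr_eq0 => [|l _]; last exact: sqr_ge0.
apply: contra vi => /allP all0; pose P := rVpoly (\row_j v j).
have root_x l : root P (x l).
  have := all0 l (mem_index_enum l); rewrite /= sqrf_eq0.
  under eq_bigr do rewrite mxE mulrAC -mulrA.
  rewrite -big_distrr mulf_eq0 sqrtr_eq0 leNgt exprn_gt0 //= => /eqP S0.
  apply/eqP; rewrite (horner_coef_wide _ (size_poly _ _)) -[RHS]S0.
  by apply: eq_bigr => j _; rewrite coef_rVpoly_ord mxE.
have [P0|P0] := eqVneq P 0.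
  by have := coef_rVpoly_ord (\row_j v j) i; rewrite -/P P0 coef0 mxE => <-.
have : all (root P) [seq x l | l <- enum 'I_n] by apply/allP => _ /mapP[l _ ->].
move=> /(max_poly_roots P0); rewrite map_inj_uniq ?enum_uniq => [/(_ isT)|].
  rewrite size_map size_enum_ord => nP.
  by have := leq_trans (leq_trans nP (size_poly _ _)) kn; rewrite ltnn.
by move=> a b /eqP; rewrite eqr_nat eqSS => /eqP/val_inj.
Qed.

(** For positive [a] the power is differentiable at [a]; for [a = 0] the expression is [e]^ t * b
    [^ t], which tends to 0 from the right because [0 < t]. *)
Lemma cvg_powR_affine (R : realType) (a b t : R) : 0 <= a -> 0 < b -> 0 < t ->
  ((a + e * b) `^ t @[e --> 0^'+] --> a `^ t)%classic.
Proof.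
rewrite le_eqVlt => /predU1P[<-|a0] b0 t0.
  rewrite powR0 ?gt_eqF// -[X in (_ --> X)%classic](mul0r (b `^ t)).
  apply: (@cvg_trans _ ((e `^ t * b `^ t) @[e --> 0^'+])%classic).
    apply: near_eq_cvg; near=> e; rewrite add0r powRM// ltW//.
  by apply: cvgMr_tmp; exact: powR_cvg0.
apply: cvg_at_right_filter.
have ab0 : 0 < a + 0 * b by rewrite mul0r addr0.
have dv := is_derive_affine_powR 1 t ab0.
have /derivable1_diffP dp :
  derivable (fun y : R => (a + y * b) `^ t * 1) 0 1 by exact: ex_derive.
have -> : a `^ t = (a + 0 * b) `^ t * 1 by rewrite mul0r addr0 mulr1.
apply: cvg_trans (differentiable_continuous dp).
by apply: near_eq_cvg; apply: nearW => e; rewrite mulr1.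
Unshelve. all: end_near. Qed.

Lemma cvg_det (R : realType) (k : nat) (F : R -> 'M[R]_k) (L : 'M[R]_k) :
  (forall i j, (F e i j @[e --> 0^'+] --> L i j)%classic) ->
  (\det (F e) @[e --> 0^'+] --> \det L)%classic.
Proof.
move=> FL; apply: cvg_big => [|s _]; first exact: add_continuous.
apply: cvgM; first exact: cvg_cst.
by apply: cvg_big => [|i _]; [exact: mul_continuous|exact: FL].
Qed.

Theorem theorem5p11 (R : realType) (r n : nat) (A : 'M[R]_n) (t : R) :
  (3 <= r)%N -> hankel A -> r%:R - 2 <= t ->
  (TN r A -> hankel (hadamard_power A t) /\ TN r (hadamard_power A t)) /\
  (TP r A -> hankel (hadamard_power A t) /\ TP r (hadamard_power A t)).
Proof.
move=> r3 hA rt; have r0 : (0 < r)%N by apply: leq_trans r3.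
(* From [3 <= r] one even gets [1 <= t]. *)
have t0 : 0 < t.
  apply: lt_le_trans rt; have : 3%:R <= r%:R :> R by rewrite ler_nat.
  by clear; lra.
have hAt : hankel (hadamard_power A t).
  by move=> i j i' j' e; rewrite !mxE (hA _ _ _ _ e).
have [h Ah] := hankel_seq hA.
split=> [A_TN|A_TP]; split=> //; last first.
  apply: (contiguous_pd_TP r0 rt t0 Ah) => k p q kr pk qk.
  exact: TP_contiguous_pd Ah A_TP kr pk qk.
pose w := power_sums R n.
(* Each contiguous block of [Ae e] of size at most [r] is semidefinite plus [e] times positive
   definite, so for [0 < e] the strict case applies to it. *)
pose Ae (e : R) : 'M[R]_n := \matrix_(i, j) (A i j + e * w (i + j)%N).
have Ae_TP e : 0 < e -> TP r (hadamard_power (Ae e) t).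
  move=> e0; pose he s := h s + e * w s.
  apply: (@contiguous_pd_TP _ _ _ _ he) => // [i j|k p q kr pk qk].
    by rewrite mxE Ah.
  have [X XE] := TN_contiguous_gram Ah A_TN kr pk qk.
  have -> : contiguous he k p q = X^T *m X + e *: contiguous w k p q.
    by rewrite -XE; apply/matrixP => i j; rewrite !mxE.
  have [sw pw] : pd (contiguous w k p q).
    by apply: power_sums_pd; apply: leq_trans pk; rewrite leq_addl.
  split=> [|v vn0]; first by rewrite linearD linearZ /= sw (gram_psd X).1.
  by rewrite qfD qfZ ltr_wpDl ?(gram_psd X).2// mulr_gt0 ?pw.
move=> k f g kr fi gi.
(* The minor of the power of [A] is the limit of these positive minors as [e] tends to 0 from the
   right. *)
pose d (e : R) := \det (mxsub f g (hadamard_power (Ae e) t)).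
apply: (@cvgr_to_ge R (0^'+)%classic _ R d).
  apply: cvg_det => i j; rewrite !mxE.
  under eq_cvg do rewrite !mxE.
  apply: cvg_powR_affine => //.
    have := A_TN 1%N (fun=> f i) (fun=> g j); rewrite det_mx11 mxE; apply=> //.
      by move=> a b; rewrite !ord1.
    by move=> a b; rewrite !ord1.
  (* [f i] serves as an element of ['I_n], making the power sum nonempty and hence positive. *)
  rewrite /w /power_sums (bigD1 (f i)) //= ltr_pwDl ?exprn_gt0 ?ltr0n//.
  by apply: sumr_ge0 => l _; rewrite exprn_ge0.
by near=> e; apply/ltW/Ae_TP.
Unshelve. all: end_near. Qed.
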